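(* Let $n\geq3$ and let $\alpha$ be a non-zero element of $\mathbb{H}_\varepsilon^\perp\subset\mathbb{A}_{n+1}$. Then $$\mathbb{O}_\alpha:=\mathrm{Span}\{e_0,\widetilde{\varepsilon},\varepsilon,\widetilde{e}_0,\widetilde{\alpha},\alpha\varepsilon,\widetilde{\varepsilon}\alpha,\alpha\}\subset\mathbb{A}_{n+1}$$ is an $8$-dimensional vector subspace of $\mathbb{A}_{n+1}=\mathbb{R}^{2^{n+1}}$.
   Context: Cayley-Dickson algebras: $\mathbb{A}_0=\mathbb{R}$ with $\overline{x}=x$, and $\mathbb{A}_{m+1}=\mathbb{A}_m\times\mathbb{A}_m$ with product $(a,b)(x,y)=(ax-\overline{y}b,\;ya+b\overline{x})$ and conjugation $\overline{(x_1,x_2)}=(\overline{x}_1,-x_2)$. $\mathbb{A}_m=\mathbb{R}^{2^m}$ carries the standard inner product; $\perp$ denotes orthogonal complement. $e_0$ is the unit of each algebra. For $m\geq1$, $\widetilde{e}_0:=(0,e_0)\in\mathbb{A}_m$ (the same symbol is used in each $\mathbb{A}_m$), and for $a=(a_1,a_2)\in\mathbb{A}_m$, $\widetilde{a}:=(-a_2,a_1)$. $\varepsilon:=(\widetilde{e}_0,0)\in\mathbb{A}_{n+1}$ (with $\widetilde{e}_0\in\mathbb{A}_n$), and $\mathbb{H}_\varepsilon:=\mathrm{Span}\{e_0,\widetilde{\varepsilon},\varepsilon,\widetilde{e}_0\}\subset\mathbb{A}_{n+1}$ (with $\widetilde{e}_0\in\mathbb{A}_{n+1}$). $\mathbb{H}_\varepsilon^\perp$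 is its orthogonal complement in $\mathbb{A}_{n+1}$. *)

(* Defs.v *)
From HB Require Import structures.
From mathcomp Require Import all_boot all_order all_algebra.
From mathcomp Require Import reals.

Set Implicit Arguments.
Unset Strict Implicit.
Unset Printing Implicit Defensive.

Import GRing.Theory.
Local Open Scope ring_scope.

(* The recursion runs in [vectType R], so that spans and dimensions are those
   of [vector], and [CD R m.+1] is convertible to [(CD R m * CD R m)%type]. *)
Fixpoint CD (R : realType) (m : nat) : vectType R :=
  if m is m'.+1 then (CD R m' * CD R m')%type : vectType R
  else (R^o : vectType R).

Fixpoint cd_conj (R : realType) (m : nat) : CD R m -> CD R m :=
  match m return CD R m -> CD R m with
  | 0 => fun x => x
  | m'.+1 => fun x => (cd_conj x.1, - x.2)
  end.

Fixpoint cd_mul (R : realType) (m : nat) : CD R m -> CD R m -> CD R m :=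
  match m return CD R m -> CD R m -> CD R m with
  | 0 => fun x y => (x : R) * (y : R)
  | m'.+1 => fun u v =>
      (cd_mul u.1 v.1 - cd_mul (cd_conj v.2) u.2,
       cd_mul v.2 u.1 + cd_mul u.2 (cd_conj v.1))
  end.

(* The standard inner product of R^(2^m), the 2^m real coordinates being
   the leaves of the iterated pair. *)
Fixpoint cd_dot (R : realType) (m : nat) : CD R m -> CD R m -> R :=
  match m return CD R m -> CD R m -> R with
  | 0 => fun x y => (x : R) * (y : R)
  | m'.+1 => fun u v => cd_dot u.1 v.1 + cd_dot u.2 v.2
  end.

Fixpoint cd_e0 (R : realType) (m : nat) : CD R m :=
  match m return CD R m with
  | 0 => (1 : R)
  | m'.+1 => (cd_e0 R m', 0)
  end.

(* Only meaningful for [0 < m]; the value at [m = 0] is a dummy. *)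
Definition cd_te0 (R : realType) (m : nat) : CD R m :=
  match m return CD R m with
  | 0 => 0
  | m'.+1 => (0, cd_e0 R m')
  end.

Definition cd_tilde (R : realType) (m : nat) (a : CD R m.+1) : CD R m.+1 :=
  (- a.2, a.1).

(* Only meaningful for [0 < n], see [cd_te0]. *)
Definition cd_eps (R : realType) (n : nat) : CD R n.+1 := (cd_te0 R n, 0).

Definition cd_Heps (R : realType) (n : nat) : {vspace CD R n.+1} :=
  <<[:: cd_e0 R n.+1; cd_tilde (cd_eps R n); cd_eps R n; cd_te0 R n.+1]>>%VS.

Definition in_orthocomp (R : realType) (m : nat) (U : {vspace CD R m})
    (a : CD R m) : Prop :=
  forall u : CD R m, u \in U -> cd_dot a u = 0.

Definition cd_Oalpha (R : realType) (n : nat) (alpha : CD R n.+1) :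
    {vspace CD R n.+1} :=
  <<[:: cd_e0 R n.+1; cd_tilde (cd_eps R n); cd_eps R n; cd_te0 R n.+1;
        cd_tilde alpha; cd_mul alpha (cd_eps R n);
        cd_mul (cd_tilde (cd_eps R n)) alpha; alpha]>>%VS.

Lemma dim_CD (R : realType) (m : nat) : \dim {: CD R m} = (2 ^ m)%N.
Proof.
rewrite dimvf; elim: m => [|m IHm] //=.
by rewrite expnS mul2n -addnn -[in RHS]IHm.
Qed.

(* Main.v *)
Require Import Defs.
From HB Require Import structures.
From mathcomp Require Import all_boot all_order all_algebra.
From mathcomp Require Import reals.
From mathcomp Require Import ring.

Set Implicit Arguments.
Unset Strict Implicit.
Unset Printing Implicit Defensive.

Import GRing.Theory.
Local Open Scope ring_scope.

(* The eight spanning vectors are nonzero and pairwise orthogonal.  Write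
   alpha = (a, b).  Orthogonality to H_eps says that the four halves of a and b
   are orthogonal to the unit, hence change sign under conjugation, and this
   gives alpha eps = (a~, - b~) and eps~ alpha = (b~, a~).  Together with
   alpha = (a, b) and alpha~ = (- b, a), the last four vectors are obtained
   from alpha by signed permutations of these four halves, like 1, i, j, k
   acting on a quaternion. *)

Lemma cd_dotC (R : realType) m (x y : CD R m) : cd_dot x y = cd_dot y x.
Proof.
elim: m x y => [|m IH] x y /=; first exact: mulrC.
by rewrite (IH x.1) (IH x.2).
Qed.

Lemma cd_dot_is_linear (R : realType) m (x : CD R m) :
  linear (cd_dot x : CD R m -> R^o).
Proof.
elim: m x => [|m IH] x c y z /=; first by rewrite /GRing.scale /=; ring.
by rewrite (IH x.1 c y.1 z.1) (IH x.2 c y.2 z.2) /GRing.scale /=; ring.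
Qed.

HB.instance Definition _ (R : realType) m (x : CD R m) :=
  GRing.isLinear.Build R (CD R m) R^o _ (cd_dot x) (@cd_dot_is_linear R m x).

Lemma cd_dot0r (R : realType) m (x : CD R m) : cd_dot x 0 = 0.
Proof. exact: linear0. Qed.

Lemma cd_dotNr (R : realType) m (x y : CD R m) : cd_dot x (- y) = - cd_dot x y.
Proof. exact: linearN. Qed.

Lemma cd_dot0l (R : realType) m (x : CD R m) : cd_dot 0 x = 0.
Proof. by rewrite cd_dotC cd_dot0r. Qed.

Lemma cd_dotNl (R : realType) m (x y : CD R m) : cd_dot (- x) y = - cd_dot x y.
Proof. by rewrite cd_dotC cd_dotNr cd_dotC. Qed.

Lemma cd_dot_ge0 (R : realType) m (x : CD R m) : 0 <= cd_dot x x.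
Proof.
elim: m x => [|m IH] x /=; first by rewrite -expr2 Num.Theory.sqr_ge0.
exact: Num.Theory.addr_ge0.
Qed.

Lemma cd_dot_eq0 (R : realType) m (x : CD R m) : (cd_dot x x == 0) = (x == 0).
Proof.
elim: m x => [|m IH] x /=; first by rewrite mulf_eq0 orbb.
by rewrite Num.Theory.paddr_eq0 ?cd_dot_ge0 // !IH; case: x.
Qed.

(** If [x] were in the span of the later vectors, expanding only the right factor of [cd_dot x x] in
    them would give 0, and definiteness would force [x = 0]. *)
Lemma cd_orthogonal_free (R : realType) m (s : seq (CD R m)) :
  pairwise (fun u v => cd_dot u v == 0) s -> 0 \notin s -> free s.
Proof.
elim: s => [|x s IH] /=; first by rewrite nil_free.
rewrite in_cons negb_or => /andP[/allP x_perp s_perp] /andP[x0 s0].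
rewrite free_cons IH // andbT; apply: contra x0 => xs.
rewrite eq_sym -cd_dot_eq0 {2}(coord_span (X := in_tuple s) xs) linear_sum /=.
rewrite big1 // => i _; rewrite linearZ /=.
by rewrite (eqP (x_perp _ (mem_nth _ (ltn_ord i)))) scaler0.
Qed.

Lemma cd_conj0 (R : realType) m : cd_conj (0 : CD R m) = 0.
Proof. by elim: m => //= m ->; rewrite oppr0. Qed.

Lemma cd_conjN (R : realType) m (x : CD R m) : cd_conj (- x) = - cd_conj x.
Proof. by elim: m x => //= m IH x; rewrite (IH x.1). Qed.

Lemma cd_conj_e0 (R : realType) m : cd_conj (cd_e0 R m) = cd_e0 R m.
Proof. by elim: m => //= m ->; rewrite oppr0. Qed.

(** Conjugation fixes only the real coordinate, which the recursion keeps in the first half; all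
    other coordinates already change sign. *)
Lemma cd_conj_imaginary (R : realType) m (x : CD R m) :
  cd_dot x (cd_e0 R m) = 0 -> cd_conj x = - x.
Proof.
elim: m x => [|m IH] x /=; first by rewrite mulr1 => ->; rewrite oppr0.
by rewrite cd_dot0r addr0 => /IH ->.
Qed.

(** Both sides are proved together, here and for the unit and the sign, because the recursive
    product exchanges left and right factors. *)
Lemma cd_mul0 (R : realType) m (x : CD R m) :
  cd_mul x 0 = 0 /\ cd_mul 0 x = 0.
Proof.
elim: m x => [|m IH] x /=; first by rewrite mulr0 mul0r.
rewrite cd_conj0.
by rewrite !(fun y => proj1 (IH y)) !(fun y => proj2 (IH y)) subr0 addr0.
Qed.

Lemma cd_mulx0 (R : realType) m (x : CD R m) : cd_mul x 0 = 0.
Proof. by case: (cd_mul0 x). Qed.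

Lemma cd_mul0x (R : realType) m (x : CD R m) : cd_mul 0 x = 0.
Proof. by case: (cd_mul0 x). Qed.

Lemma cd_mul1 (R : realType) m (x : CD R m) :
  cd_mul x (cd_e0 R m) = x /\ cd_mul (cd_e0 R m) x = x.
Proof.
elim: m x => [|m IH] x /=; first by rewrite mulr1 mul1r.
rewrite cd_conj0 cd_conj_e0 !cd_mulx0 !cd_mul0x.
rewrite !(fun y => proj1 (IH y)) !(fun y => proj2 (IH y)).
by rewrite !subr0 add0r addr0; case: x.
Qed.

Lemma cd_mulx1 (R : realType) m (x : CD R m) : cd_mul x (cd_e0 R m) = x.
Proof. by case: (cd_mul1 x). Qed.

Lemma cd_mul1x (R : realType) m (x : CD R m) : cd_mul (cd_e0 R m) x = x.
Proof. by case: (cd_mul1 x). Qed.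

Lemma cd_mulN (R : realType) m (x y : CD R m) :
  cd_mul x (- y) = - cd_mul x y /\ cd_mul (- x) y = - cd_mul x y.
Proof.
elim: m x y => [|m IH] x y /=; first by rewrite mulrN mulNr.
rewrite !cd_conjN.
rewrite !(fun x y => proj1 (IH x y)) !(fun x y => proj2 (IH x y)).
by split; congr pair; rewrite /= opprD.
Qed.

Lemma cd_mulxN (R : realType) m (x y : CD R m) :
  cd_mul x (- y) = - cd_mul x y.
Proof. by case: (cd_mulN x y). Qed.

Lemma cd_mulNx (R : realType) m (x y : CD R m) :
  cd_mul (- x) y = - cd_mul x y.
Proof. by case: (cd_mulN x y). Qed.

Theorem corollary3p2 (R : realType) (n : nat) (hn : (3 <= n)%N)
  (alpha : CD R n.+1) (halpha0 : alpha != 0)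
  (halpha : in_orthocomp (cd_Heps R n) alpha) :
  \dim (cd_Oalpha alpha) = 8%N.
Proof.
(* From here on [n] is the predecessor of the original one, so [alpha] splits into four quarters in
   [CD R n]. Each generator of [cd_Heps] is the unit placed in one quarter. *)
case: n hn alpha halpha0 halpha => [//|n] _ [[a1 a2] [b1 b2]] alpha0 alpha_perp.
have perp u : u \in [:: cd_e0 R n.+2; cd_tilde (cd_eps R n.+1); cd_eps R n.+1;
    cd_te0 R n.+2] -> cd_dot (((a1, a2), (b1, b2)) : CD R n.+2) u = 0.
  by move=> /memv_span; exact: alpha_perp.
have a1_im : cd_dot a1 (cd_e0 R n) = 0.
  have := perp (cd_e0 R n.+2).
  by rewrite !inE eqxx => /(_ isT) /=; rewrite !cd_dot0r !addr0.
have b2_im : cd_dot b2 (cd_e0 R n) = 0.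
  have := perp (cd_tilde (cd_eps R n.+1)).
  rewrite !inE eqxx orbT => /(_ isT) /=.
  by rewrite !cd_dotNr !cd_dot0r !oppr0 !add0r.
have a2_im : cd_dot a2 (cd_e0 R n) = 0.
  have := perp (cd_eps R n.+1).
  by rewrite !inE eqxx !orbT => /(_ isT) /=; rewrite !cd_dot0r !addr0 add0r.
have b1_im : cd_dot b1 (cd_e0 R n) = 0.
  have := perp (cd_te0 R n.+2).
  by rewrite !inE eqxx !orbT => /(_ isT) /=; rewrite !cd_dot0r !addr0 add0r.
pose zeroE := (oppr0, subr0, sub0r, addr0, add0r, opprK).
(* Right multiplication by [cd_te0] is the tilde map, and conjugating [cd_te0] changes the sign on
   the second half. *)
have alpha_eps : cd_mul (((a1, a2), (b1, b2)) : CD R n.+2) (cd_eps R n.+1)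
    = ((- a2, a1), (b2, - b1)).
  rewrite /= !cd_conjN !cd_conj0 !cd_conj_e0.
  rewrite !(cd_mulNx, cd_mulxN, cd_mulx0, cd_mul0x, cd_mulx1, cd_mul1x).
  by do 2!apply: injective_projections; rewrite /= !zeroE.
(* With t = [cd_te0], the product is (- conj(b) t, t conj(a)); the imaginary quarters give conj(b) =
   - b and t conj(a) = a~. *)
have teps_alpha : cd_mul (cd_tilde (cd_eps R n.+1))
    (((a1, a2), (b1, b2)) : CD R n.+2) = ((- b2, b1), (- a2, a1)).
  rewrite /= !cd_conjN !cd_conj0 !cd_conj_e0.
  rewrite !(cd_conj_imaginary a1_im, cd_conj_imaginary a2_im,
            cd_conj_imaginary b1_im, cd_conjN).
  rewrite !(cd_mulNx, cd_mulxN, cd_mulx0, cd_mul0x, cd_mulx1, cd_mul1x).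
  by do 2!apply: injective_projections; rewrite /= !zeroE.
have alpha_norm :
    cd_dot a1 a1 + cd_dot a2 a2 + (cd_dot b1 b1 + cd_dot b2 b2) != 0.
  by rewrite -cd_dot_eq0 in alpha0.
have e0_neq0 : cd_dot (cd_e0 R n) (cd_e0 R n) != 0.
  by elim: (n) => [|m IH] /=; rewrite ?mulr1 ?oner_neq0 // cd_dot0r addr0.
rewrite /cd_Oalpha alpha_eps teps_alpha.
(* Once 8 is read as [size s], the boolean form of the goal is [free s] by definition. *)
set s := (X in <<X>>%VS); rewrite -[8%N]/(size s).
apply/eqP; apply: cd_orthogonal_free; rewrite {}/s.
  rewrite /= !(cd_dotNl, cd_dotNr, cd_dot0l, cd_dot0r).
  rewrite !(cd_dotC (cd_e0 R n)) !(a1_im, a2_im, b1_im, b2_im).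
  rewrite !(oppr0, subr0, addr0, add0r) eqxx /= !andbT.
  (* Only the six products among the last four vectors remain; symmetry of [cd_dot] puts their terms
     in a common order so that they cancel. *)
  do ?[apply/andP; split]; apply/eqP;
    by rewrite ?(cd_dotC b2) ?(cd_dotC b1) ?(cd_dotC a2); ring.
rewrite !inE ![0 == _]eq_sym -!cd_dot_eq0.
rewrite /= !(cd_dotNl, cd_dotNr, cd_dot0l, cd_dot0r) !zeroE.
rewrite !negb_or e0_neq0 alpha_norm /= andbT.
(* The three vectors left have the squared norm of [alpha], with its four terms permuted. *)
do ?[apply/andP; split]; apply: contra alpha_norm => /eqP norm0;
  by apply/eqP; rewrite -[RHS]norm0; ring.
Qed.
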